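(* Let $R$ be a ring. Each of the following conditions implies that $R$ is a BF-ring: (1) $R$ is right artinian; (2) $R$ is a right noetherian prime ring whose right Krull dimension (in the sense of Gabriel--Rentschler) equals $1$.
   Context: Rings are associative with identity. For a ring $R$, $R^\times$ is the group of units and $R^\bullet$ is the multiplicative monoid of cancellative elements (elements that are neither left nor right zero-divisors). A nonunit $u\in R^\bullet$ is an atom if $u=ab$ with $a,b\in R^\bullet$ implies that $a$ or $b$ is a unit. $R$ is a BF-ring (has bounded factorizations) if every nonunit of $R^\bullet$ is a finite product of atoms of $R^\bullet$ and for every $a\in R^\bullet$ there is $\lambda(a)\in\mathbb{Z}_{\ge 0}$ such that $k\le\lambda(a)$ whenever $a=u_1\cdots u_k$ with atoms $u_1,\dots,u_k$ of $R^\bullet$. *)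

(* Defs.v *)
From mathcomp Require Import all_boot all_algebra.
From mathcomp Require Import classical_sets.

Set Implicit Arguments.
Unset Strict Implicit.
Unset Printing Implicit Defensive.

Import GRing.Theory.
Local Open Scope classical_set_scope.
Local Open Scope ring_scope.

Section Factorizations.
Variable R : pzRingType.

(* GRing.unit is a boolean predicate and is only available on unitRingType. *)
Definition is_unit (x : R) : Prop := exists y : R, x * y = 1 /\ y * x = 1.

Definition cancellative (x : R) : Prop := GRing.lreg x /\ GRing.rreg x.

Definition atom (u : R) : Prop :=
  [/\ cancellative u, ~ is_unit u &
      forall a b : R, cancellative a -> cancellative b ->
        u = a * b -> is_unit a \/ is_unit b].

Definition atomic_factorization (a : R) (s : seq R) : Prop :=
  (forall u : R, u \in s -> atom u) /\ a = \prod_(u <- s) u.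

Definition BF_ring : Prop :=
  (forall a : R, cancellative a -> ~ is_unit a ->
     exists s : seq R, atomic_factorization a s)
  /\
  (forall a : R, cancellative a ->
     exists lambda : nat, forall s : seq R,
       atomic_factorization a s -> (size s <= lambda)%N).

End Factorizations.

Section Deviation.
Variables (T : Type) (le : T -> T -> Prop).

(* [dev_lt n A] says that the subposet [A] of [T] has deviation < n.  It covers
   the finite values only: the deviation of a trivial poset, one without two
   distinct comparable elements, is -oo, hence < 0; and the deviation is < n+1
   if in every descending chain a_0 >= a_1 >= ... of [A] all but finitely many
   of the factors {x in A | a_(i+1) <= x <= a_i} have deviation < n. *)
Fixpoint dev_lt (n : nat) (A : set T) : Prop :=
  match n with
  | 0 => forall x y : T, A x -> A y -> le x y -> x = y
  | n'.+1 =>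
      forall a : nat -> T,
        (forall i, A (a i)) -> (forall i, le (a i.+1) (a i)) ->
        exists N : nat, forall i : nat, (N <= i)%N ->
          dev_lt n' [set x | [/\ A x, le (a i.+1) x & le x (a i)]]
  end.

Definition has_deviation (A : set T) (n : nat) : Prop :=
  dev_lt n.+1 A /\ ~ dev_lt n A.

End Deviation.

Section ChainConditions.
Variable R : pzRingType.

Definition right_ideal (I : set R) : Prop :=
  [/\ I 0, (forall x y : R, I x -> I y -> I (x + y))
    & forall x r : R, I x -> I (x * r)].

Definition right_artinian : Prop :=
  forall I : nat -> set R, (forall i, right_ideal (I i)) ->
    (forall i, I i.+1 `<=` I i) ->
    exists N : nat, forall i : nat, (N <= i)%N -> I i = I N.

Definition right_noetherian : Prop :=
  forall I : nat -> set R, (forall i, right_ideal (I i)) ->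
    (forall i, I i `<=` I i.+1) ->
    exists N : nat, forall i : nat, (N <= i)%N -> I i = I N.

Definition prime_ring : Prop :=
  (1 : R) <> 0 /\
  forall a b : R, (forall r : R, a * r * b = 0) -> a = 0 \/ b = 0.

(* The Gabriel-Rentschler dimension of the right module R_R is the deviation of
   its lattice of submodules: the submodule lattice of a subfactor J/I is the
   interval of right ideals between I and J. *)
Definition right_Krull_dim (n : nat) : Prop :=
  has_deviation (@subset R) [set I : set R | right_ideal I] n.

End ChainConditions.

(* Main.v *)
Require Import Defs.
From mathcomp Require Import all_boot all_algebra.
From mathcomp Require Import boolp classical_sets.

(** The theorem rests on one criterion ([BF_of_bounded_lengths]): a ring is a
    BF-ring as soon as, for each cancellative [a], the lengths of all
    factorizations of [a] into cancellative nonunits, atoms or not, are bounded.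
    Indeed a factorization of maximal length has only atoms as factors, since a
    factor that is not an atom could be split further.

    In a right artinian ring every cancellative element is a unit: the chain of
    the right ideals [a ^+ n R] stabilizes, and cancelling [a ^+ n] in
    [a ^+ n = a ^+ n.+1 * r] gives [a * r = 1].  So only the empty factorization
    exists.

    In case (2), a factorization [a = u_1 ... u_k] into nonunits yields the
    strictly descending chain of right ideals
    [R > u_1 R > u_1 u_2 R > ... > a R], so it suffices that the module [R / aR]
    has finite length.  It is noetherian because [R] is.  It is artinian because
    all factors of the chain [R >= a R >= a^2 R >= ...] are isomorphic to
    [R / aR] by left multiplication with a power of [a]: deviation at most one
    makes almost all of them artinian ([interval_dcc]).  The passage from the
    two chain conditions to a bound on the lengths of chains goes through the
    additivity of such bounds ([chain_bound_add]), a form of the Jordan-Hoelder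
    theorem that needs only the modular law. *)

Set Implicit Arguments.
Unset Strict Implicit.
Unset Printing Implicit Defensive.

Import GRing.Theory.
Local Open Scope classical_set_scope.
Local Open Scope ring_scope.

(** * Cancellative elements and factorizations into nonunits *)

Section Factorizations.
Variable R : pzRingType.
Implicit Types (a b u : R) (s : seq R).

Definition nonunit_factorization a s :=
  (forall u, u \in s -> cancellative u /\ ~ is_unit u) /\ a = \prod_(u <- s) u.

Lemma unit_of_right_inverse a r : GRing.lreg a -> a * r = 1 -> is_unit a.
Proof.
move=> areg ar1; exists r; split=> //.
by apply: areg; rewrite mulrA ar1 mul1r mulr1.
Qed.

Lemma BF_of_bounded_lengths :
  (forall a, cancellative a -> exists n : nat, forall s,
     nonunit_factorization a s -> (size s <= n)%N) ->
  BF_ring R.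
Proof.
move=> bounded; split=> [a areg aNunit|a areg]; last first.
  have [n le_n] := bounded a areg; exists n => s [satoms aE]; apply: le_n.
  by split=> // u /satoms[].
have [n le_n] := bounded a areg.
pose len k := `[< exists2 s, nonunit_factorization a s & size s = k >].
have ex_len : exists k, len k.
  exists 1%N; apply/asboolP; exists [:: a] => //; split; last by rewrite big_seq1.
  by move=> u; rewrite inE => /eqP ->.
have len_le k : len k -> (k <= n)%N by move=> /asboolP[s /le_n + <-].
case: (ex_maxnP ex_len len_le) => k /asboolP[s [snu aE] sizes] kmax.
exists s; split=> // u us; have [ureg uNunit] := snu u us.
split=> // b c breg creg uE; apply: contrapT => /not_orP[bNunit cNunit].
case/splitPr: us snu aE sizes => s1 s2 snu aE sizes.
suff /kmax : len k.+1 by rewrite ltnn.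
apply/asboolP; exists (s1 ++ [:: b, c & s2]); last first.
  by rewrite -sizes !size_cat /= !addnS.
split=> [v|]; last by rewrite aE !big_cat /= !big_cons uE !mulrA.
rewrite mem_cat !inE => /or4P[vs1|/eqP->|/eqP->|vs2] //; apply: snu.
  by rewrite mem_cat vs1.
by rewrite mem_cat inE vs2 !orbT.
Qed.

End Factorizations.

(** * Right ideals *)

Section RightIdeals.
Variable R : pzRingType.
Implicit Types (a : R) (I J K : set R) (c : nat -> set R).

Definition principal a : set R := [set x | exists r, x = a * r].

Definition lmul_ideal a I : set R := [set x | exists2 y, I y & x = a * y].

Definition ideal_sum I J : set R := [set x | exists y z, [/\ I y, J z & x = y + z]].

Lemma right_ideal_principal a : right_ideal (principal a).
Proof.
split=> [|x y [r ->] [s ->]|x r [s ->]].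
- by exists 0; rewrite mulr0.
- by exists (r + s); rewrite mulrDr.
- by exists (s * r); rewrite mulrA.
Qed.

Lemma right_ideal_lmul a I : right_ideal I -> right_ideal (lmul_ideal a I).
Proof.
case=> I0 ID IM; split=> [|x y [r Ir ->] [s Is ->]|x r [s Is ->]].
- by exists 0; rewrite ?mulr0.
- by exists (r + s); [exact: ID|rewrite mulrDr].
- by exists (s * r); [exact: IM|rewrite mulrA].
Qed.

Lemma right_ideal_setI I J :
  right_ideal I -> right_ideal J -> right_ideal (I `&` J).
Proof.
move=> [I0 ID IM] [J0 JD JM]; split=> // [x y [? ?] [? ?]|x r [? ?]].
  by split; [exact: ID|exact: JD].
by split; [exact: IM|exact: JM].
Qed.

Lemma right_ideal_sum I J :
  right_ideal I -> right_ideal J -> right_ideal (ideal_sum I J).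
Proof.
move=> [I0 ID IM] [J0 JD JM]; split.
- by exists 0, 0; rewrite addr0.
- move=> _ _ [y [z [Iy Jz ->]]] [y' [z' [Iy' Jz' ->]]].
  exists (y + y'), (z + z'); split; [exact: ID|exact: JD|].
  by rewrite addrACA.
- move=> _ r [y [z [Iy Jz ->]]]; exists (y * r), (z * r).
  by split; [exact: IM|exact: JM|rewrite mulrDl].
Qed.

Lemma right_idealB I x y : right_ideal I -> I x -> I y -> I (x - y).
Proof. by case=> _ ID IM Ix Iy; rewrite -mulrN1; apply: ID => //; apply: IM. Qed.

Lemma lmul_ideal_inj a : GRing.lreg a -> injective (lmul_ideal a).
Proof.
move=> areg.
have sub I J : lmul_ideal a I = lmul_ideal a J -> I `<=` J.
  move=> IJ x Ix; have : lmul_ideal a I (a * x) by exists x.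
  by rewrite IJ => -[y Jy /areg ->].
by move=> I J IJ; apply/seteqP; split; apply: sub.
Qed.

Lemma principal_unit a : GRing.lreg a -> principal a 1 -> is_unit a.
Proof. by move=> areg [r /esym]; apply: unit_of_right_inverse. Qed.

Lemma artinian_cancellative_unit a :
  right_artinian R -> cancellative a -> is_unit a.
Proof.
move=> art [areg _].
have [||N stable] := art (fun i => principal (a ^+ i)).
- by move=> i; apply: right_ideal_principal.
- by move=> i _ [r ->]; exists (a * r); rewrite mulrA -exprSr.
have : principal (a ^+ N) (a ^+ N) by exists 1; rewrite mulr1.
rewrite -(stable N.+1) // => -[r]; rewrite exprSr -mulrA -{1}[a ^+ N]mulr1.
by move/(lregX areg)/esym; apply: unit_of_right_inverse.
Qed.

(** * Bounded chains of right ideals *)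

(** Weakly descending chains, of which only the strict steps are counted, are
    stable under intersection with and addition of a fixed ideal; strict chains
    would not be. *)
Definition chain_bound n I J := forall c,
  (forall i, [/\ right_ideal (c i), I `<=` c i & c i `<=` J]) ->
  (forall i, c i.+1 `<=` c i) ->
  forall k, (\sum_(i < k) `[< c i.+1 <> c i >] <= n)%N.

(** By the modular law, a strict step of a chain stays strict after
    intersecting with [K] or after adding [K]. *)
Lemma chain_bound_add m n I J K :
  right_ideal K -> I `<=` K -> K `<=` J -> right_ideal J ->
  chain_bound m I K -> chain_bound n K J -> chain_bound (m + n) I J.
Proof.
move=> idK IK KJ [_ JD _] bm bn c cIJ cdesc k.
have idc i : right_ideal (c i) by have [] := cIJ i.
have := leq_add (bm (fun i => c i `&` K) _ _ k) (bn (fun i => ideal_sum (c i) K) _ _ k).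
rewrite -big_split => /(_ _ _ _ _) le_mn.
apply: leq_trans (le_mn _ _ _ _); last first.
- by move=> i _ [y [z [cy Kz ->]]]; exists y, z; split=> //; apply: cdesc.
- move=> i; have [idci Ici cJ] := cIJ i; split; first exact: right_ideal_sum.
    by move=> x Kx; exists 0, x; rewrite add0r; split=> //; case: idci.
  by move=> _ [y [z [cy Kz ->]]]; apply: JD; [exact: cJ|exact: KJ].
- by move=> i x [cx Kx]; split=> //; apply: cdesc.
- move=> i; have [idci Ici cJ] := cIJ i.
  by split; [exact: right_ideal_setI|move=> x Ix; split; auto|move=> x []].
apply: leq_sum => i _.
case: asboolP => // step; rewrite lt0n addn_eq0 !eqb0; apply/negP.
case/andP=> /asboolPn/contrapT capE /asboolPn/contrapT sumE; apply: step.
apply/seteqP; split=> [|x cx]; first exact: cdesc.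
have : ideal_sum (c i) K x by exists x, 0; rewrite addr0; split=> //; case: idK.
rewrite -sumE => -[y [z [cy Kz xE]]].
have zE : z = x - y by rewrite xE addrAC subrr add0r.
have : (c i `&` K) z.
  by split=> //; rewrite zE; apply: right_idealB => //; apply: cdesc.
rewrite -capE => -[cz _]; rewrite xE; have [_ cD _] := idc i.+1; exact: cD.
Qed.

Lemma chain_bound_simple I J :
  (forall K, right_ideal K -> I `<=` K -> K `<=` J -> K = I \/ K = J) ->
  chain_bound 1 I J.
Proof.
move=> simple c cIJ cdesc k.
have cE i : c i = I \/ c i = J by have [] := cIJ i; apply: simple.
(* The only possible strict step goes from [J] to [I]; the right-hand side
   records whether it has already been made. *)
suff : (\sum_(i < k) `[< c i.+1 <> c i >] <= `[< c k <> J >])%N.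
  by move/leq_trans; apply; case: `[< _ >].
elim: k => [|k IHk]; first by rewrite big_ord0.
rewrite big_ord_recr /=.
have [ckJ|ckJ] := pselect (c k = J).
  move: IHk; rewrite ckJ; case: (asboolP (J <> J)) => // _.
  by rewrite leqn0 => /eqP ->.
have [ckI|//] := cE k.
have ckk : c k.+1 = c k.
  apply/seteqP; split=> [|x]; first exact: cdesc.
  by rewrite ckI => Ix; have [_ + _] := cIJ k.+1; apply.
by rewrite ckk; case: (asboolP (c k <> c k)) => // _; rewrite addn0.
Qed.

End RightIdeals.

(** * Finite length from the two chain conditions *)

(** Dependent choice, in the form that turns both chain conditions into the
    existence of extremal ideals. *)
Lemma exists_terminal (T : Type) (P : T -> Prop) (r : T -> T -> Prop) (x0 : T) :
  P x0 ->
  (forall f : nat -> T, (forall i, P (f i)) -> ~ (forall i, r (f i) (f i.+1))) ->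
  exists2 x, P x & forall y, P y -> ~ r x y.
Proof.
move=> Px0 nochain; apply: contrapT => noterm.
have next (x : {x | P x}) : {y : {x | P x} | r (sval x) (sval y)}.
  apply: cid; apply: contrapT => noy; apply: noterm; exists (sval x).
    exact: svalP.
  by move=> y Py rxy; apply: noy; exists (exist _ y Py).
pose f i := iter i (fun x => sval (next x)) (exist _ x0 Px0).
apply: (nochain (fun i => sval (f i))) => i; first exact: svalP.
exact: svalP (next (f i)).
Qed.

Section FiniteLength.
Variable R : pzRingType.
Implicit Types (a : R) (I J K : set R) (c : nat -> set R).

Definition dcc_above I := forall c,
  (forall i, right_ideal (c i) /\ I `<=` c i) -> (forall i, c i.+1 `<=` c i) ->
  exists i, c i.+1 = c i.

(** Multiplication by [a ^+ N] carries the right ideals above [aR] into the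
    factor of [a ^+ N R] by [a ^+ N.+1 R]. *)
Lemma interval_dcc a :
  dev_lt (@subset R) 2 [set I : set R | right_ideal I] -> GRing.lreg a ->
  dcc_above (principal a).
Proof.
move=> dev areg c cI cdesc.
have [||N /(_ N (leqnn N)) devN] := dev (fun i => principal (a ^+ i)).
- by move=> i; apply: right_ideal_principal.
- by move=> i _ [r ->]; exists (a * r); rewrite mulrA -exprSr.
pose d i := lmul_ideal (a ^+ N) (c i).
have ddesc i : d i.+1 `<=` d i.
  by move=> _ [y cy ->]; exists y => //; apply: cdesc.
have dI i : [set I | [/\ right_ideal I, principal (a ^+ N.+1) `<=` I
                        & I `<=` principal (a ^+ N)]] (d i).
  have [idci aci] := cI i; split; first exact: right_ideal_lmul.
    by move=> _ [r ->]; exists (a * r); [apply: aci; exists r|rewrite mulrA -exprSr].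
  by move=> _ [y _ ->]; exists y.
have [M /(_ M (leqnn M)) devM] := devN d dI ddesc.
exists M; apply: (lmul_ideal_inj (lregX (n:=N) areg)).
by apply: (devM (d M.+1) (d M)) (ddesc M); split.
Qed.

(** Take [K] minimal among the right ideals above [I] with bounded chains
    between [K] and [R].  If [K] were not [I], a right ideal maximal among those
    strictly below [K] and above [I] would contradict the minimality of [K]. *)
Lemma finite_length I :
  right_noetherian R -> right_ideal I -> dcc_above I ->
  exists n, chain_bound n I setT.
Proof.
move=> noeth idI dcc.
pose P K := [/\ right_ideal K, I `<=` K & exists n, chain_bound n K setT].
have [||K [idK IK [n bn]] Kmin] :=
    @exists_terminal _ P (fun K J => J `<=` K /\ J <> K) setT.
- split=> //; exists 1%N; apply: chain_bound_simple => K _ TK _.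
  by left; apply/seteqP.
- move=> f fP fdesc; have [||i fi] := dcc f.
  + by move=> i; have [] := fP i.
  + by move=> i; have [] := fdesc i.
  + by have [_] := fdesc i.
have [<-|KI] := pselect (K = I); first by exists n.
pose Q J := [/\ right_ideal J, I `<=` J, J `<=` K & J <> K].
have [||J [idJ IJ JK JneK] Jmax] :=
    @exists_terminal _ Q (fun J J' => J `<=` J' /\ J' <> J) I.
- by split=> //; apply/eqP; rewrite eq_sym; apply/eqP.
- move=> f fQ finc; have [||N fN] := noeth f.
  + by move=> i; have [] := fQ i.
  + by move=> i; have [] := finc i.
  + by have [_] := finc N; apply; apply: fN.
have simple : chain_bound 1 J K.
  apply: chain_bound_simple => L idL JL LK.
  have [->|LneK] := pselect (L = K); first by right.
  left; apply: contrapT => LneJ; apply: (Jmax L) => //.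
  by split=> //; apply: subset_trans JL.
case: (Kmin J) => //; split=> //.
by exists (1 + n)%N; apply: chain_bound_add simple bn.
Qed.

(** The products of the initial segments of a factorization of [a] into [k]
    nonunits generate a chain above [aR] with [k] strict steps. *)
Lemma length_le_chain_bound a n s :
  chain_bound n (principal a) setT -> nonunit_factorization a s ->
  (size s <= n)%N.
Proof.
move=> bn [snu aE]; pose p i := \prod_(u <- take i s) u.
have preg i : GRing.lreg (p i).
  rewrite /p big_seq_cond; elim/big_ind: _ => [|x y|u].
  - exact: lreg1.
  - exact: lregM.
  - by rewrite andbT => /mem_take /snu[[]].
have pS i : (i < size s)%N -> p i.+1 = p i * s`_i.
  by move=> lti; rewrite /p (take_nth 0) // -cats1 big_cat big_seq1.
apply: leq_trans (bn (fun i => principal (p i)) _ _ (size s)).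
- rewrite (eq_bigr (fun=> 1%N)) ?sum1_card ?card_ord // => i _.
  case: asboolP => // pE; exfalso; apply: pE => pE.
  have [[ureg _] uNunit] := snu _ (mem_nth 0 (ltn_ord i)).
  apply: uNunit; apply: (principal_unit ureg).
  have : principal (p i) (p i) by exists 1; rewrite mulr1.
  rewrite -pE => -[r]; rewrite pS // -mulrA -{1}[p i]mulr1 => /preg ->.
  by exists r.
- move=> i; split=> //; first exact: right_ideal_principal.
  move=> _ [r ->]; exists (\prod_(u <- drop i s) u * r).
  by rewrite mulrA -big_cat cat_take_drop -aE.
- move=> i; have [lti|lei] := ltnP i (size s).
    by move=> _ [r ->]; exists (s`_i * r); rewrite mulrA -pS.
  by rewrite /p !take_oversize // ltnW.
Qed.

End FiniteLength.

Theorem proposition3p1 (R : pzRingType) :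
  (right_artinian R -> BF_ring R) /\
  (right_noetherian R -> prime_ring R -> right_Krull_dim R 1 -> BF_ring R).
Proof.
split=> [art|noeth _ [dev _]]; apply: BF_of_bounded_lengths => a areg.
  exists 0%N => -[//|u s] [/(_ u (mem_head _ _))[ureg uNunit] _].
  by case: uNunit; apply: artinian_cancellative_unit.
have [n bn] := finite_length noeth (right_ideal_principal a)
                 (interval_dcc dev (proj1 areg)).
by exists n => s; apply: length_le_chain_bound.
Qed.
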